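(* For every $\epsilon \in (0,1]$ and all integers $s\geq 0$ and $t\geq 3$ with $s \leq \frac{\epsilon}{100}\,\frac{t}{\ln t}$, for every graph $H$ with exactly $s+t$ vertices and every set $S$ of $s$ vertices in $H$, $$f(H) \leq 4\lceil (1+\epsilon)f(H-S)\rceil.$$
   Context: Graphs are finite and simple. For a graph $G$, $d(G)$ denotes the average degree of $G$, i.e. $d(G)=2|E(G)|/|V(G)|$. A graph $H$ is a minor of a graph $G$ (equivalently, $G$ contains an $H$-minor) if a graph isomorphic to $H$ can be constructed from $G$ by vertex deletion, edge deletion and edge contraction. For a graph $H$, define $$f(H) := \inf\{D \in \mathbb{R} : \text{every graph } G \text{ with } d(G)\geq D \text{ contains an } H\text{-minor}\}.$$ For $S\subseteq V(H)$, $H-S$ is the graph obtained from $H$ by deleting the vertices in $S$. *)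

(* Defs.v *)
(* MathComp + MathComp-Analysis; the reals are an arbitrary [R : realType]. *)
From HB Require Import structures.
From mathcomp Require Import all_boot all_order all_algebra.
From mathcomp Require Import boolp classical_sets reals exp.

Set Implicit Arguments.
Unset Strict Implicit.
Unset Printing Implicit Defensive.

Import Order.TTheory GRing.Theory Num.Theory.

Record sgraph := SGraph {
  vertex :> finType;
  adj : rel vertex;
  adj_sym : symmetric adj;
  adj_irrefl : irreflexive adj }.

Definition isomorphic (G H : sgraph) : Prop :=
  exists f : G -> H, bijective f /\ forall x y, adj (f x) (f y) = adj x y.

Section Operations.
Variable G : sgraph.

Section DelVertices.
Variable S : {set G}.

Definition del_vertices_rel : rel {x : G | x \notin S} :=
  fun x y => adj (val x) (val y).

Lemma del_vertices_sym : symmetric del_vertices_rel.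
Proof. by move=> x y; exact: adj_sym. Qed.

Lemma del_vertices_irrefl : irreflexive del_vertices_rel.
Proof. by move=> x; exact: adj_irrefl. Qed.

Definition del_vertices := SGraph del_vertices_sym del_vertices_irrefl.
End DelVertices.

Section EdgeOperations.
Variables u v : G.

Definition del_edge_rel : rel G :=
  fun x y => adj x y && ([set x; y] != [set u; v]).

Lemma del_edge_sym : symmetric del_edge_rel.
Proof. by move=> x y; rewrite /del_edge_rel adj_sym finset.setUC. Qed.

Lemma del_edge_irrefl : irreflexive del_edge_rel.
Proof. by move=> x; rewrite /del_edge_rel adj_irrefl. Qed.

Definition del_edge := SGraph del_edge_sym del_edge_irrefl.

(* Contraction of the edge uv: v is removed and u plays the role of the merged
   vertex, taking over the neighbours of v; loops and parallel edges vanish. *)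
Definition contract_rel : rel {x : G | x != v} := fun x y =>
  (x != y) &&
  [|| adj (val x) (val y),
      (val x == u) && adj v (val y)
    | (val y == u) && adj v (val x)].

Lemma contract_sym : symmetric contract_rel.
Proof.
move=> x y; rewrite /contract_rel eq_sym (adj_sym (val x)).
by congr (_ && (_ || _)); rewrite orbC.
Qed.

Lemma contract_irrefl : irreflexive contract_rel.
Proof. by move=> x; rewrite /contract_rel eqxx. Qed.

Definition contract := SGraph contract_sym contract_irrefl.
End EdgeOperations.

Definition edges : {set {set G}} :=
  [set [set p.1; p.2] | p : G * G & adj p.1 p.2]%SET.

End Operations.

(* [minor H G]: H is a minor of G. *)
Inductive minor (H : sgraph) : sgraph -> Prop :=
| minor_iso (G : sgraph) : isomorphic G H -> minor H G
| minor_del_vertex (G : sgraph) (v : G) : minor H (del_vertices [set v]%SET) -> minor H G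
| minor_del_edge (G : sgraph) (u v : G) : adj u v -> minor H (del_edge u v) -> minor H G
| minor_contract (G : sgraph) (u v : G) : adj u v -> minor H (contract u v) -> minor H G.

Local Open Scope ring_scope.

Definition avg_degree (R : realType) (G : sgraph) : R :=
  2 * #|edges G|%:R / #|G|%:R.

(* The average degree is only meaningful for graphs with at least one vertex,
   so G ranges over those. [inf] is the infimum in R; it is junk (0) on sets
   that are empty or not bounded below. The set below is never empty (Mader),
   and when H has at least two vertices it is bounded below by 0, since the
   one-vertex graph has average degree 0 and no H-minor. *)
Definition minor_density (R : realType) (H : sgraph) : R :=
  inf [set D : R | forall G : sgraph,
         (0 < #|G|)%N -> D <= avg_degree R G -> minor H G]%classic.

(* Main.v *)
Require Import Defs.
From HB Require Import structures.
From mathcomp Require Import boolp classical_sets reals sequences exp.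
From mathcomp Require Import all_boot all_order all_algebra.
From mathcomp Require Import zify lra.

(** Write L = H - S, let f be the density of L, and let m be the ceiling of
    (1 + eps) f. Since the complete graph on t - 1 vertices has average degree
    t - 2 and no minor on t vertices, f >= t - 2 > 0, so that f < m and
    t <= 2 m. If no average degree forces L, none forces H, and both
    densities are the infimum 0 of the empty set. Otherwise it is enough that
    every graph G of average degree at least 4 m has H as a minor.

    Reduce G by deleting superfluous edges and isolated vertices, and by
    contracting every edge that lies in fewer than 2 m triangles; the average
    degree stays at least 4 m ([minor_of_dense_nbhd]). At the end some vertex v
    has between 1 and 4 m neighbours, and each of them has at least 2 m
    neighbours inside N(v). All the work now happens inside N(v).

    In a connected graph on at most 4 m vertices of minimum degree at least m,
    a connected dominating set of size O(log m) exists
    ([small_connected_dominating_set]): ten vertices suffice to have every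
    vertex within distance two, and then some vertex always dominates a
    quarter of what is left, at the cost of two new vertices. Take such a set
    D, remove it, pass to a component of the rest, and repeat #|S| times
    ([model_in_dense_set]). Every set found later, and whatever is left at the
    end, lies in the part that D dominates. So the sets D serve as branch sets
    for the vertices of S, adjacent to each other and to every branch set of
    any model of L in the remaining part.

    The bound on s makes the total number of removed vertices at most m
    ([dominating_sets_fit]), so the remaining part has minimum degree at least
    m > f and does contain L as a minor. However large m is compared with t,
    the count works, because log m is at most log t + m / t. *)

Set Implicit Arguments.
Unset Strict Implicit.
Unset Printing Implicit Defensive.

Import Order.TTheory GRing.Theory Num.Theory.

(** * Minors as families of branch sets *)

Lemma connect_homo (T T' : finType) (e : rel T) (e' : rel T') (f : T -> T') :
  (forall x y, e x y -> connect e' (f x) (f y)) ->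
  forall x y, connect e x y -> connect e' (f x) (f y).
Proof.
move=> he x y /connectP[p]; elim: p x => [|z p IHp] x /=.
  by move=> _ ->; exact: connect0.
by move=> /andP[exz pz] yE; exact: connect_trans (he _ _ exz) (IHp _ pz yE).
Qed.

Definition adj_in (G : sgraph) (A : {pred G}) : rel G :=
  fun x y => [&& adj x y, x \in A & y \in A].

Definition connected (G : sgraph) (A : {pred G}) : Prop :=
  {in A &, forall x y, connect (adj_in A) x y}.

(** The branch set of a vertex h is the fibre of [phi] over [Some h], which
    makes distinct branch sets disjoint for free. The set X allows a model of
    an induced subgraph of H to be grown vertex by vertex inside a fixed type. *)
Record model (H G : sgraph) (X : {set H}) (phi : G -> option H) : Prop := Model {
  model_range : forall x h, phi x = Some h -> h \in X;
  model_nonempty : forall h, h \in X -> exists x, phi x = Some h;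
  model_connected : forall h, connected [pred x | phi x == Some h];
  model_adj : forall h k, h \in X -> k \in X -> adj h k ->
    exists x y, [/\ phi x = Some h, phi y = Some k & adj x y] }.

Lemma model_induced (H G : sgraph) (X : {set H}) (B : {set G})
    (phi : del_vertices B -> option H) :
  model X phi -> model X (fun x : G => obind phi (insub x)).
Proof.
move=> [rg ne co ad]; set psi := fun x : G => _.
have psi_val a : psi (val a) = phi a by rewrite /psi valK.
have psiP x h : psi x = Some h -> exists2 a, x = val a & phi a = Some h.
  by rewrite /psi; case: insubP => //= a _ <- pa; exists a.
split.
- by move=> x h /psiP[a _ /rg].
- by move=> h /ne[a pa]; exists (val a); rewrite psi_val.
- move=> h x y; rewrite !inE => /eqP/psiP[a -> pa] /eqP/psiP[b -> pb].
  have : connect (adj_in [pred a | phi a == Some h]) a b.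
    by apply: co; rewrite !inE ?pa ?pb.
  apply: (connect_homo (f := val)) => c d /and3P[cd hc hd]; apply: connect1.
  by rewrite /adj_in !inE !psi_val; apply/and3P.
- move=> h k hX kX /(ad h k hX kX)[a [b [pa pb ab]]].
  by exists (val a), (val b); rewrite !psi_val.
Qed.

Lemma adj_neq (G : sgraph) (x y : G) : adj x y -> x != y.
Proof. by apply: contraTneq => ->; rewrite adj_irrefl. Qed.

Section Contract.
Variables (G : sgraph) (u v : G) (uv : adj u v).

(** The quotient map of the contraction, onto the vertices other than v. *)
Definition fuse (x : G) : contract u v := insubd (Sub u (adj_neq uv) : contract u v) x.

Lemma fuseK (a : contract u v) : fuse (val a) = a.
Proof. exact: valKd. Qed.

Lemma val_fuse (x : G) : val (fuse x) = if x == v then u else x.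
Proof. by rewrite val_insubd; case: eqP. Qed.

Lemma fuse_adj (x y : G) :
  adj x y -> fuse x = fuse y \/ adj (fuse x) (fuse y).
Proof.
move=> xy; have xny := adj_neq xy.
case: (fuse x =P fuse y) => [|/eqP ne]; [by left | right].
rewrite /= /contract_rel ne !val_fuse.
have [xv|xv] := eqVneq x v; have [yv|yv] := eqVneq y v.
- by rewrite xv yv eqxx in xny.
- by rewrite eqxx -xv xy orbT.
- by rewrite eqxx -yv (adj_sym y x) xy !orbT.
- by rewrite xy.
Qed.

Lemma contract_adj (a b : contract u v) : adj a b ->
  exists x y, [/\ fuse x = a, fuse y = b & adj x y].
Proof.
move=> /andP[ab /or3P[adj_ab|/andP[/eqP au vb]|/andP[/eqP bu va]]].
- by exists (val a), (val b); rewrite !fuseK.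
- exists v, (val b); rewrite !fuseK; split=> //.
  by apply: val_inj; rewrite val_fuse eqxx.
- exists (val a), v; rewrite !fuseK adj_sym; split=> //.
  by apply: val_inj; rewrite val_fuse eqxx.
Qed.

Lemma connect_fuse (A : {pred contract u v}) (x y : G) :
  fuse x \in A -> fuse y \in A -> (fuse x = fuse y) ->
  connect (adj_in [pred z | fuse z \in A]) x y.
Proof.
move=> xA yA xy; have [->|xny] := eqVneq x y; first exact: connect0.
apply: connect1; rewrite /adj_in !inE xA yA andbT.
move: (congr1 val xy); rewrite !val_fuse.
case: (eqVneq x v) => [xv|xv]; case: (eqVneq y v) => [yv|yv] E.
- by rewrite xv yv eqxx in xny.
- by rewrite xv -E adj_sym uv.
- by rewrite E yv uv.
- by rewrite E eqxx in xny.
Qed.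

(** Paths inside a branch set carry over in both directions: at the merged
    vertex, the edge uv supplies the detour that a step of the contracted graph
    may need in G. *)
Lemma model_contract (H : sgraph) (X : {set H}) (phi : contract u v -> option H) :
  model X phi <-> model X (phi \o fuse).
Proof.
split=> -[rg ne co ad]; split.
- by move=> x h /rg.
- by move=> h /ne[a pa]; exists (val a); rewrite /= fuseK.
- move=> h x y; rewrite !inE => /eqP px /eqP py.
  pose A := [pred a | phi a == Some h].
  have xy : connect (adj_in A) (fuse x) (fuse y) by apply: co; rewrite !inE; apply/eqP.
  suff : connect (adj_in [pred z | fuse z \in A]) (val (fuse x)) (val (fuse y)).
    move=> mid; apply: (connect_trans (y := val (fuse x))).
      by apply: (connect_fuse (A := A)); rewrite ?fuseK // inE; apply/eqP.
    apply: (connect_trans mid).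
    by apply: (connect_fuse (A := A)); rewrite ?fuseK // inE; apply/eqP.
  move: xy; apply: (connect_homo (f := val)) => a b /and3P[/contract_adj[c [d [<- <- cd]]] ca da].
  apply: (connect_trans (y := c)); first by apply: (connect_fuse (A := A)); rewrite ?fuseK.
  apply: (connect_trans (y := d)); last by apply: (connect_fuse (A := A)); rewrite ?fuseK.
  by apply: connect1; apply/and3P.
- move=> h k hX kX /(ad h k hX kX)[a [b [pa pb /contract_adj[c [d [ca db cd]]]]]].
  by exists c, d; rewrite /= ca db.
- by move=> a h pa; apply: (rg (val a)); rewrite /= fuseK.
- by move=> h /ne[x px]; exists (fuse x).
- move=> h a b pa pb; rewrite -(fuseK a) -(fuseK b).
  have : connect (adj_in [pred x | (phi \o fuse) x == Some h]) (val a) (val b).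
    by apply: co; rewrite !inE /= fuseK.
  apply: (connect_homo (f := fuse)) => x y /and3P[/fuse_adj[-> _ _|xy hx hy]]; first exact: connect0.
  by apply: connect1; apply/and3P.
- move=> h k hX kX hk; have [x [y [px py xy]]] := ad h k hX kX hk.
  have [E|] := fuse_adj xy; last by exists (fuse x), (fuse y).
  by move: px py hk; rewrite /= E => -> [->]; rewrite adj_irrefl.
Qed.
End Contract.

Lemma minor_model (H G : sgraph) :
  minor H G -> exists phi : G -> option H, model [set: H] phi.
Proof.
elim=> {G} [G [f [[g fK gK] fadj]]|G v _ [phi /model_induced]|G u v _ _ [phi]|G u v uv _ [phi]].
- exists (Some \o f); split=> //=.
  + by move=> h _; exists (g h); rewrite gK.
  + move=> h x y; rewrite !inE => /eqP[<-] /eqP[/(can_inj fK)<-]; exact: connect0.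
  + move=> h k _ _ hk; exists (g h), (g k); rewrite /= !gK; split=> //.
    by rewrite -fadj !gK.
- by eexists; eassumption.
- move=> [rg ne co ad]; exists phi; split=> //.
  + move=> h x y xh yh; have := co h x y xh yh.
    by apply: (connect_homo (f := id)) => a b /and3P[/andP[ab _] ha hb]; apply: connect1; apply/and3P.
  + move=> h k hX kX /(ad h k hX kX)[x [y [px py /andP[xy _]]]].
    by exists x, y.
- by move=> /(model_contract uv); eexists; eassumption.
Qed.

(** Ordered pairs are easier to map along deletions and contractions than
    two-element sets; each edge gives two arcs. *)
Definition arcs (G : sgraph) : {set G * G} := [set p | adj p.1 p.2].

Lemma eq_set2 (T : finType) (x y u v : T) :
  ([set x; y] == [set u; v]) = ((x, y) == (u, v)) || ((x, y) == (v, u)).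
Proof.
apply/eqP/orP => [/setP E|[]/eqP[-> ->] //]; last exact: setUC.
have /esym := E x; have /esym := E y; have := E u; have := E v.
rewrite !inE !eqxx !orbT /= !xpair_eqE => Ev Eu.
case/orP=> /eqP y_uv; case/orP=> /eqP x_uv; subst; rewrite ?eqxx /=; auto.
  by left; rewrite eq_sym; case/orP: Ev.
by right; rewrite eq_sym; case/orP: Eu.
Qed.

Lemma arcs_del_edge (G : sgraph) (u v : G) :
  (arcs (del_edge u v) : {set G * G}) = arcs G :\: [set (u, v); (v, u)].
Proof.
by apply/setP=> -[x y]; rewrite !inE /= /del_edge_rel eq_set2 andbC.
Qed.

Lemma card_arcs_del_edge (G : sgraph) (u v : G) : adj u v ->
  #|arcs (del_edge u v)| < #|arcs G| <= #|arcs (del_edge u v)| + 2.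
Proof.
move=> uv; rewrite arcs_del_edge.
set B := [set (u, v); (v, u)].
have card_B : #|B| <= 2 by rewrite cards2; case: eqP.
have : #|arcs G :&: B| <= 2 by apply: leq_trans card_B; exact/subset_leq_card/subsetIr.
have : 0 < #|arcs G :&: B|.
  by apply/card_gt0P; exists (u, v); rewrite !inE eqxx uv.
by rewrite -(cardsID B (arcs G)); set b := #|_ :&: _|; set c := #|_ :\: _|; lia.
Qed.

Lemma spanning_minor (H G : sgraph) (f : G -> H) : bijective f ->
  (forall x y, adj (f x) (f y) -> adj x y) -> minor H G.
Proof.
move=> fbij; have [n] := ubnP #|arcs G|; elim: n G f fbij => // n IHn G f fbij leGn fadj.
have [/existsP[u /existsP[v /andP[uv nfuv]]]|] :=
    boolP [exists u, exists v, adj u v && ~~ adj (f u) (f v)].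
  apply: (minor_del_edge uv); apply: (IHn (del_edge u v) f fbij).
    by have := card_arcs_del_edge uv; move: leGn; lia.
  move=> x y fxy; rewrite /= /del_edge_rel fadj //= eq_set2 negb_or.
  apply/andP; split; apply: contraNneq nfuv => -[<- <-] //.
  by rewrite adj_sym.
move=> /existsPn noedge; apply: minor_iso; exists f; split=> // x y.
apply/idP/idP; first exact: fadj.
move=> xy; apply/negPn/negP => nf; have /existsPn/(_ y)/negP := noedge x.
by apply; apply/andP.
Qed.

Lemma model_del_vertex (H G : sgraph) (X : {set H}) (phi : G -> option H) (v : G) :
  phi v = None -> model X phi -> model X (fun x : del_vertices [set v] => phi (val x)).
Proof.
move=> pv [rg ne co ad].
have some_notin x h : phi x = Some h -> x \notin [set v].
  by move=> px; rewrite inE; apply: contra_eqN px => /eqP->; rewrite pv.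
have lift x h : phi x = Some h -> exists a : del_vertices [set v], x = val a.
  by move=> /some_notin xv; exists (Sub x xv).
split.
- by move=> x h /rg.
- by move=> h /ne[x px]; have [a xa] := lift _ _ px; exists a; rewrite -xa.
- move=> h a b; rewrite !inE => pa pb; have := co h _ _ pa pb.
  rewrite -{2}(valKd a a) -{2}(valKd a b).
  apply: (connect_homo (f := insubd a)) => x y /and3P[xy]; rewrite !inE => px py.
  have [c xc] := lift _ _ (eqP px); have [d yd] := lift _ _ (eqP py).
  rewrite xc yd !valKd; apply: connect1; apply/and3P; rewrite !inE -xc -yd; split=> //.
  by rewrite /= /del_vertices_rel -xc -yd.
- move=> h k hX kX /(ad h k hX kX)[x [y [px py xy]]].
  have [a xa] := lift _ _ px; have [b yb] := lift _ _ py.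
  by exists a, b; rewrite -xa -yb; split=> //=; rewrite /del_vertices_rel -xa -yb.
Qed.

Lemma card_del_vertices (G : sgraph) (B : {set G}) : #|del_vertices B| = #|~: B|.
Proof. by rewrite card_sig; apply: eq_card => x; rewrite !inE. Qed.

Lemma card_del_vertex (G : sgraph) (v : G) : #|G| = #|del_vertices [set v]|.+1.
Proof. by rewrite card_del_vertices -(cardsC [set v]) cards1. Qed.

Lemma card_contract (G : sgraph) (u v : G) : #|G| = #|contract u v|.+1.
Proof.
rewrite card_sig (cardD1 v) inE; congr _.+1.
by apply: eq_card => x; rewrite !inE andbT.
Qed.

(** Delete the vertices outside all branch sets and contract an edge inside a
    branch set as long as there is one. A connected branch set without inner
    edges is a single vertex, so what remains is H with extra edges. *)
Lemma model_minor (H G : sgraph) (phi : G -> option H) :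
  model [set: H] phi -> minor H G.
Proof.
have [n] := ubnP #|G|; elim: n G phi => // n IHn G phi leGn mod.
have [v /eqP pv|total] := pickP [pred v | phi v == None].
  apply: minor_del_vertex (IHn _ _ _ (model_del_vertex pv mod)).
  by rewrite -ltnS -card_del_vertex.
have [/existsP[u /existsP[v /andP[uv /eqP puv]]]|noedge] :=
    boolP [exists u, exists v, adj u v && (phi u == phi v)].
  apply: (minor_contract uv); apply: (IHn _ (fun a : contract u v => phi (val a))).
    by rewrite -ltnS -(card_contract u v).
  apply/(model_contract uv); suff -> : (fun a : contract u v => phi (val a)) \o fuse uv = phi by [].
  by apply/funext=> x /=; rewrite val_fuse; case: eqP => // ->.
have [rg ne co ad] := mod.
have pI : injective phi.
  move=> x y pxy; case px: (phi x) => [h|]; last by have := total x; rewrite /= px eqxx.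
  have /connectP[[|z p] /= ] : connect (adj_in [pred x | phi x == Some h]) x y.
    by apply: co; rewrite inE -?pxy px.
    by [].
  rewrite {1}/adj_in !inE px => /andP[/and3P[xz _ /eqP pz] _] _.
  by case/negP: noedge; apply/existsP; exists x; apply/existsP; exists z; rewrite xz px pz eqxx.
have /fin_all_exists[f fP] : forall x, exists h, phi x = Some h.
  by move=> x; have := total x; rewrite /=; case: (phi x) => // h _; exists h.
have /fin_all_exists[g gP] : forall h, exists x, phi x = Some h.
  by move=> h; apply: ne; rewrite inE.
apply: (spanning_minor (f := f)).
  exists g => [x|h]; first by apply: pI; rewrite gP fP.
  by apply: Some_inj; rewrite -fP gP.
move=> x y fxy; have [a [b [pa pb ab]]] := ad _ _ (in_setT _) (in_setT _) fxy.
have -> : x = a by apply: pI; rewrite fP pa.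
by have -> : y = b by apply: pI; rewrite fP pb.
Qed.

Lemma minor_del_vertices (H G : sgraph) (S : {set H}) :
  minor H G -> minor (del_vertices S) G.
Proof.
move=> /minor_model[phi [_ ne co ad]].
pose psi x : option (del_vertices S) := obind insub (phi x).
have psiE x h : (psi x == Some h) = (phi x == Some (val h)).
  rewrite /psi; case: (phi x) => //= k; case: insubP => [a _ <-|kS].
    by rewrite !(inj_eq Some_inj) (inj_eq val_inj).
  by apply/esym/eqP => -[kE]; rewrite kE (valP h) in kS.
have psiP x h : phi x = Some (val h) -> psi x = Some h.
  by move=> /eqP px; apply/eqP; rewrite psiE.
apply: (model_minor (phi := psi)); split=> //.
- by move=> h _; have [x /psiP px] := ne (val h) (in_setT _); exists x.
- move=> h x y; rewrite !inE !psiE => px py; have := co _ x y px py.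
  apply: (connect_homo (f := id)) => a b /and3P[ab pa pb]; apply: connect1.
  by move: pa pb; rewrite /adj_in !inE !psiE ab => -> ->.
- move=> h k _ _ hk.
  have [x [y [/psiP px /psiP py xy]]] := ad (val h) (val k) (in_setT _) (in_setT _) hk.
  by exists x, y.
Qed.

(** Lets a minor given by the density of H - S be extended to a model of H. *)
Lemma model_of_del_vertices (H G : sgraph) (S : {set H}) (phi : G -> option (del_vertices S)) :
  model [set: del_vertices S] phi -> model (~: S) (fun x => omap val (phi x)).
Proof.
move=> [_ ne co ad]; set psi := fun x => _.
have psiP x h : psi x = Some h -> exists2 a, phi x = Some a & val a = h.
  by rewrite /psi; case: (phi x) => //= a [<-]; exists a.
have psiI x a : phi x = Some a -> psi x = Some (val a) by rewrite /psi => ->.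
have lift h : h \in ~: S -> exists a : del_vertices S, h = val a.
  by rewrite inE => hS; exists (Sub h hS).
split.
- by move=> x h /psiP[a _ <-]; rewrite inE (valP a).
- by move=> h /lift[a ->]; have [x /psiI px] := ne a (in_setT _); exists x.
- move=> h x y; rewrite !inE => /eqP/psiP[a pa <-] /eqP/psiP[b pb /val_inj ba].
  have : connect (adj_in [pred x | phi x == Some a]) x y.
    by apply: co; rewrite inE ?pa ?pb ?ba.
  apply: (connect_homo (f := id)) => c d /and3P[cd]; rewrite !inE => /eqP/psiI pc /eqP/psiI pd.
  by apply: connect1; rewrite /adj_in cd !inE pc pd eqxx.
- move=> h k /lift[a ->] /lift[b ->] ab.
  have [x [y [/psiI px /psiI py xy]]] := ad a b (in_setT _) (in_setT _) ab.
  by exists x, y.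
Qed.

Lemma minor_card (H G : sgraph) : minor H G -> #|H| <= #|G|.
Proof.
move=> /minor_model[phi [_ ne _ _]].
have /fin_all_exists[g gP] : forall h, exists x, phi x = Some h.
  by move=> h; apply: ne; rewrite inE.
by apply: (leq_card g) => h k gE; apply: Some_inj; rewrite -!gP gE.
Qed.

(** * Counting arcs *)

Definition nbr (G : sgraph) (x : G) : {set G} := [set y | adj x y].

Lemma card_arcs (G : sgraph) : #|arcs G| = (2 * #|edges G|)%N.
Proof.
rewrite -sum1_card (partition_big_imset (fun p : G * G => [set p.1; p.2])) /=.
have -> : [set [set p.1; p.2] | p in arcs G] = edges G.
  by apply/setP=> e; apply/imsetP/imsetP=> -[p pG ->]; exists p => //; move: pG; rewrite !inE.
rewrite mulnC -sum_nat_const; apply: eq_bigr => e /imsetP[[x y] /=]; rewrite inE /= => xy ->.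
rewrite sum1_card -(_ : #|[set (x, y); (y, x)]| = 2).
  apply: eq_card => -[a b]; rewrite unfold_in /= eq_set2 !inE /= andbC.
  by case: orP => //= -[]/eqP[-> ->] //; rewrite adj_sym xy.
by rewrite cards2 xpair_eqE (negPf (adj_neq xy)).
Qed.

Lemma sum_degrees (G : sgraph) : #|arcs G| = \sum_(x : G) #|nbr x|.
Proof.
rewrite -sum1_card; under [RHS]eq_bigr => x _ do rewrite -sum1_card.
by rewrite pair_big_dep; apply: eq_bigl => p; rewrite !inE.
Qed.

Lemma arcs_induced (G : sgraph) (A : {set G}) (k : nat) :
  {in A, forall x, k <= #|nbr x :&: A|} ->
  k * #|A| <= #|arcs (del_vertices (~: A))|.
Proof.
move=> degA; rewrite sum_degrees -{1}(setCK A) -card_del_vertices mulnC -sum_nat_const.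
apply: leq_sum => a _; have aA : val a \in A by have := valP a; rewrite inE negbK.
apply: leq_trans (degA _ aA) _.
apply: leq_trans (leq_imset_card val _); apply/subset_leq_card/subsetP=> y.
rewrite !inE => /andP[ay yA]; have yNA : y \notin ~: A by rewrite inE negbK.
by apply/imsetP; exists (Sub y yNA); rewrite ?inE ?SubK.
Qed.

Definition complete_rel (n : nat) : rel 'I_n := fun x y => x != y.

Lemma complete_sym (n : nat) : symmetric (@complete_rel n).
Proof. by move=> x y; rewrite /complete_rel eq_sym. Qed.

Lemma complete_irrefl (n : nat) : irreflexive (@complete_rel n).
Proof. by move=> x; rewrite /complete_rel eqxx. Qed.

Definition complete_graph (n : nat) : sgraph :=
  SGraph (@complete_sym n) (@complete_irrefl n).

Lemma card_arcs_complete (n : nat) : #|arcs (complete_graph n)| = n * n.-1.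
Proof.
rewrite sum_degrees; have card_K : #|complete_graph n| = n := card_ord n.
transitivity (\sum_(x : complete_graph n) n.-1); last by rewrite sum_nat_const card_K.
apply: eq_bigr => x _; rewrite -[in RHS]card_K -(cardC1 x); apply: eq_card => y.
by rewrite !inE /= /complete_rel eq_sym.
Qed.

(** * A dense neighbourhood *)

(** Contracting uv destroys the edge uv and, for every common neighbour w,
    identifies vw with uw. *)
Lemma arcs_contract (G : sgraph) (u v : G) : adj u v ->
  #|arcs G| <= #|arcs (contract u v)| + 2 + 2 * #|nbr u :&: nbr v|.
Proof.
move=> uv; pose C := nbr u :&: nbr v.
pose lost := [set (u, v); (v, u)] :|: (pair v @: C :|: (fun w => (w, v)) @: C).
have card_lost : #|lost| <= 2 + 2 * #|C|.
  rewrite mul2n -addnn (leq_trans (leq_card_setU _ _)) // leq_add //.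
    by rewrite cards2; case: eqP.
  by rewrite (leq_trans (leq_card_setU _ _)) // leq_add // leq_imset_card.
have lostP x y : (x, y) \in arcs G :\: lost ->
    [/\ adj x y, ~ (x = u /\ y = v) & ~ (x = v /\ adj u y)].
  rewrite !inE !negb_or -!andbA => /and5P[ne1 ne2 nC1 nC2 xy]; split=> //.
    by case=> xu yv; rewrite xu yv eqxx in ne1.
  case=> xv uy; case/negP: nC1; apply/imsetP; exists y; last by rewrite xv.
  by rewrite !inE uy -xv.
have swap x y : (x, y) \in arcs G :\: lost -> (y, x) \in arcs G :\: lost.
  have img (f g : G -> G * G) : (forall w, (g w).1 = (f w).2 /\ (g w).2 = (f w).1) ->
      (y, x) \in f @: C -> (x, y) \in g @: C.
    move=> fg /imsetP[w Cw E]; apply/imsetP; exists w => //.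
    by have := fg w; rewrite -E /=; case: (g w) => a b /= [-> ->].
  rewrite !in_setD !inE /= adj_sym => /andP[nl ->]; rewrite andbT.
  apply: contra nl; case/or3P=> [/orP[]/eqP[-> ->]||]; rewrite ?eqxx ?orbT //.
    by move=> /(img _ (fun w => (w, v)))->; rewrite ?orbT.
  by move=> /(img _ (pair v))->; rewrite ?orbT.
(* If the end v of an arc is traded for u, the other end would be a common
   neighbour of u and v, and such arcs are in [lost]. *)
have key x y x' y' : (x, y) \in arcs G :\: lost -> (x', y') \in arcs G :\: lost ->
    fuse uv x = fuse uv x' -> fuse uv y = fuse uv y' -> x = v -> x' = v.
  move=> /lostP[xy n1 n2] /lostP[xy' n1' n2'].
  move=> /(congr1 val); rewrite !val_fuse => Ex /(congr1 val); rewrite !val_fuse => Ey xv.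
  apply/eqP; apply: contraT => x'v; move: Ex; rewrite xv eqxx (negPf x'v) => x'u.
  case: n2; split=> //; move: Ey.
  have /negPf-> : y != v by rewrite eq_sym -xv adj_neq.
  have /negPf-> : y' != v by apply/eqP=> y'v; case: n1'.
  by rewrite x'u => ->.
have fuseI x x' : (x = v -> x' = v) -> (x' = v -> x = v) ->
    fuse uv x = fuse uv x' -> x = x'.
  move=> xx' x'x /(congr1 val); rewrite !val_fuse.
  case: eqP => [xv|nxv]; case: eqP => [x'v|nx'v] //; first by rewrite xv x'v.
    by case: nx'v; exact: xx'.
  by case: nxv; exact: x'x.
pose f (p : G * G) := (fuse uv p.1, fuse uv p.2).
have finj : {in arcs G :\: lost &, injective f}.
  move=> [x y] [x' y'] B1 B2 [Ex Ey].
  have B3 := swap _ _ B1; have B4 := swap _ _ B2.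
  congr pair; apply: fuseI => //.
  - exact: key B1 B2 Ex Ey.
  - exact: key B2 B1 (esym Ex) (esym Ey).
  - exact: key B3 B4 Ey Ex.
  - exact: key B4 B3 (esym Ey) (esym Ex).
have sub : f @: (arcs G :\: lost) \subset arcs (contract u v).
  apply/subsetP=> _ /imsetP[[x y] B1 ->]; have B2 := swap _ _ B1.
  have [xy n1 n2] := lostP _ _ B1; have [yx n1' n2'] := lostP _ _ B2.
  rewrite inE; case: (fuse_adj uv xy) => // /(congr1 val); rewrite !val_fuse.
  have := adj_neq xy; case: (eqVneq x v) => [xv|xv]; case: (eqVneq y v) => [yv|yv] xny E //.
  - by rewrite xv yv eqxx in xny.
  - by case: n1'; rewrite E.
  - by case: n1; rewrite E.
  - by rewrite E eqxx in xny.
have := subset_leq_card sub; rewrite (card_in_imset finj).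
have := cardsID lost (arcs G).
have /subset_leq_card := subsetIr (arcs G) lost.
rewrite -/C; move: card_lost; move: #|lost| #|_ :&: lost| #|_ :\: lost| #|C|.
by move: #|arcs G| #|arcs (contract u v)|; lia.
Qed.

Lemma arcs_del_isolated (G : sgraph) (v : G) : nbr v = set0 ->
  #|arcs G| <= #|arcs (del_vertices [set v])|.
Proof.
move=> v0; pose f (p : del_vertices [set v] * del_vertices [set v]) := (val p.1, val p.2).
have notv x y : adj x y -> x \notin [set v].
  by move=> xy; rewrite inE; apply: contraTneq xy => ->; have /setP/(_ y) := v0; rewrite !inE => ->.
apply: leq_trans (leq_imset_card f _); apply/subset_leq_card/subsetP=> -[x y]; rewrite inE /= => xy.
have yx : adj y x by rewrite adj_sym.
apply/imsetP; exists (Sub x (notv _ _ xy), Sub y (notv _ _ yx)); last by rewrite /f /=.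
by rewrite inE.
Qed.

(** In a graph with 2k arcs per vertex that is minimal for this property, an
    edge in fewer than k triangles could be contracted: that loses at most
    2k arcs and exactly one vertex. By minimality the average degree is 2k, so
    some vertex has degree at most 2k. *)
Lemma minor_of_dense_nbhd (H : sgraph) (k : nat) : 0 < k ->
  (forall (G : sgraph) (v : G), 0 < #|nbr v| <= 2 * k ->
     {in nbr v, forall w, k <= #|nbr w :&: nbr v|} -> minor H G) ->
  forall G : sgraph, 0 < #|G| -> 2 * k * #|G| <= #|arcs G| -> minor H G.
Proof.
move=> k0 local G; have [n] := ubnP #|G|; elim: n G => // n IHn G.
have [e] := ubnP #|arcs G|; elim: e G => // e IHe G ltGe ltGn G0 dense.
have arcs_gt0 : 0 < #|arcs G| by apply: leq_trans dense; rewrite !muln_gt0 k0 G0.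
have [extra|tight] := ltnP (2 * k * #|G|) #|arcs G|.
  have /card_gt0P[[u v]] := arcs_gt0; rewrite inE /= => uv.
  apply: (minor_del_edge uv); have /andP[lt le] := card_arcs_del_edge uv.
  (* The number of arcs is even, so an excess over 2k #|G| is at least 2. *)
  apply: IHe => //; first by move: lt ltGe; lia.
  by move: extra le; rewrite !card_arcs; change #|del_edge u v| with #|G|; lia.
have [/existsP[u /existsP[v /andP[uv few]]]|many] :=
    boolP [exists u : G, exists v : G, adj u v && (#|nbr u :&: nbr v| < k)%N].
  apply: (minor_contract uv); have cG := card_contract u v.
  apply: IHn; first by rewrite -ltnS -cG.
    by apply/card_gt0P; exists (fuse uv u).
  by have := arcs_contract uv; move: dense few; rewrite cG; nia.
have [v lev] : exists v : G, #|nbr v| <= 2 * k.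
  apply/existsP; apply: contraT => /existsPn big.
  suff : (2 * k).+1 * #|G| <= #|arcs G| by move: tight G0; nia.
  rewrite sum_degrees mulnC -sum_nat_const; apply: leq_sum => v _.
  by rewrite ltnNge big.
have [v0|vn0] := posnP #|nbr v|.
  have cG := card_del_vertex v.
  have arcs_le := arcs_del_isolated (cards0_eq v0).
  apply: (@minor_del_vertex _ _ v); apply: IHn; first by rewrite -ltnS -cG.
    by have /card_gt0P[[a b] _] := leq_trans arcs_gt0 arcs_le; apply/card_gt0P; exists a.
  by apply: leq_trans arcs_le; apply: leq_trans dense; rewrite leq_mul2l cG leqnSn orbT.
apply: (local _ v); first by rewrite vn0.
move=> w; rewrite inE => vw; rewrite leqNgt; apply: contra many => few.
by apply/existsP; exists w; apply/existsP; exists v; rewrite adj_sym vw.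
Qed.

(** * Small connected dominating sets *)

Lemma connect_adj_in_sym (G : sgraph) (A : {pred G}) : connect_sym (adj_in A).
Proof.
by apply: sym_connect_sym => x y; rewrite /adj_in adj_sym; congr (_ && _); exact: andbC.
Qed.

Lemma connected_setU1 (G : sgraph) (D : {set G}) (x z : G) :
  connected D -> x \in D -> adj x z -> connected (z |: D).
Proof.
move=> conD xD xz.
have to_x a : a \in z |: D -> connect (adj_in (z |: D)) x a.
  case/setU1P=> [->|aD]; first by apply: connect1; rewrite /adj_in xz !inE xD eqxx orbT.
  have := conD x a xD aD; apply: (connect_homo (f := id)) => b c /and3P[bc bD cD].
  by apply: connect1; rewrite /adj_in bc !inE bD cD !orbT.
move=> a b aD bD; apply: (connect_trans (y := x)); last exact: to_x.
by rewrite connect_adj_in_sym; exact: to_x.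
Qed.

Lemma connected_boundary (G : sgraph) (A B : {set G}) (b : G) :
  connected A -> B \subset A -> b \in B -> A \subset B \/
  exists p q, [/\ p \in B, q \in A, q \notin B & adj p q].
Proof.
move=> conA BA bB.
have [/existsP[p /existsP[q /and4P[pB qA qB pq]]]|nobd] :=
    boolP [exists p : G, exists q : G, [&& p \in B, q \in A, q \notin B & adj p q]].
  by right; exists p, q.
left; apply/subsetP=> a aA.
have cl : closed (adj_in A) B.
  apply: intro_closed; first exact: connect_adj_in_sym.
  move=> p q /and3P[pq pA qA] pB; apply: contraT => qB; case/negP: nobd.
  by apply/existsP; exists p; apply/existsP; exists q; rewrite pB qA qB.
by rewrite -(closed_connect cl (conA _ _ (subsetP BA _ bB) aA)).
Qed.

Section Domination.
Variables (G : sgraph) (A : {set G}) (m : nat).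
Hypothesis conA : connected A.
Hypothesis degA : {in A, forall x, m <= #|nbr x :&: A|}.
Hypothesis sizeA : #|A| <= 4 * m.

(** The closed neighbourhood of D within A. *)
Definition ball (D : {set G}) : {set G} :=
  A :&: (D :|: [set y | [exists x in D, adj x y]]).

Lemma in_ball (D : {set G}) (y : G) :
  reflect (y \in A /\ (y \in D \/ exists2 x, x \in D & adj x y)) (y \in ball D).
Proof.
rewrite !inE; apply: (iffP andP) => -[yA yD]; split=> //.
  case/orP: yD => [|/existsP[x /andP[xD xy]]]; [by left | by right; exists x].
apply/orP; case: yD => [|[x xD xy]]; first by left.
by right; apply/existsP; exists x; rewrite xD.
Qed.

Lemma ball_sub (D : {set G}) : ball D \subset A.
Proof. exact: subsetIl. Qed.

Lemma ballS (D E : {set G}) : D \subset E -> ball D \subset ball E.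
Proof.
move=> /subsetP DE; apply/subsetP=> y /in_ball[yA yD]; apply/in_ball; split=> //.
by case: yD => [/DE|[x /DE xE xy]]; [left | right; exists x].
Qed.

Lemma sub_ball (D : {set G}) : D \subset A -> D \subset ball D.
Proof.
move=> /subsetP DA; apply/subsetP=> y yD; apply/in_ball.
by split; [exact: DA | left].
Qed.

Lemma card_ball1 (x : G) : x \in A -> m < #|ball [set x]|.
Proof.
move=> xA; have -> : ball [set x] = x |: (nbr x :&: A).
  apply/setP=> y; apply/in_ball/idP; rewrite !inE.
    case=> yA [->//|[z]]; rewrite inE => /eqP-> xy; by rewrite xy yA orbT.
  case/orP=> [/eqP->|/andP[xy yA]]; first by split=> //; left.
  by split=> //; right; exists x; rewrite ?inE.
by rewrite cardsU1 !inE adj_irrefl /= add1n ltnS degA.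
Qed.

Definition core (D : {set G}) : Prop := D \subset A /\ connected D.

Lemma core_attach (D : {set G}) (y : G) : core D -> y \in ball D ->
  exists D', [/\ core D', D \subset D', y \in D' & #|D'| <= #|D| + 1].
Proof.
move=> [DA conD] /in_ball[yA [yD|[x xD xy]]]; first by exists D; split; rewrite ?leq_addr.
exists (y |: D); split.
- by split; [rewrite subUset sub1set yA | exact: connected_setU1 conD xD xy].
- exact: subsetUr.
- by rewrite setU11.
- by rewrite cardsU1 addnC leq_add2l leq_b1.
Qed.

Lemma core_attach2 (D : {set G}) (y : G) : core D -> y \in ball (ball D) ->
  exists D', [/\ core D', D \subset D', y \in D' & #|D'| <= #|D| + 2].
Proof.
move=> cD /in_ball[yA yD].
have [z [zD zy]] : exists z, z \in ball D /\ (y = z \/ adj z y).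
  by case: yD => [yD|[z zD zy]]; [exists y; split; [|left] | exists z; split; [|right]].
have [D1 [cD1 DD1 zD1 leD1]] := core_attach cD zD.
have yD1 : y \in ball D1.
  by apply/in_ball; split=> //; case: zy => [->|zy]; [left | right; exists z].
have [D2 [cD2 DD2 yD2 leD2]] := core_attach cD1 yD1.
exists D2; split=> //; first exact: subset_trans DD2.
by move: leD1 leD2; clear; lia.
Qed.

(** As long as some vertex of A is at distance at least 3 from D, connectivity
    gives one, q, at distance exactly 3. The closed neighbourhood of q is
    disjoint from that of D, so attaching a path from D to q adds three
    vertices to D and more than m vertices to its closed neighbourhood. As
    #|A| <= 4m, this can happen at most three times. *)
Lemma core_near (a : G) : a \in A -> forall j,
  exists D, [/\ core D, D != set0, #|D| <= 1 + 3 * j &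
    A \subset ball (ball D) \/ j.+1 * m.+1 <= #|ball D|].
Proof.
move=> aA; elim=> [|j [D [cD D0 leD [near|big]]]].
- exists [set a]; split; rewrite ?cards1 //.
  + split; first by rewrite sub1set.
    by move=> x y; rewrite !inE => /eqP-> /eqP->; exact: connect0.
  + by apply/set0Pn; exists a; rewrite inE.
  + by right; rewrite mul1n; exact: card_ball1.
- by exists D; split; rewrite ?(leq_trans leD) ?leq_add2l ?leq_mul2l ?leqnSn //; left.
have [d dD] := set0Pn _ D0.
have dB : d \in ball (ball D).
  exact: subsetP (sub_ball (ball_sub D)) _ (subsetP (sub_ball cD.1) _ dD).
have [near|[p [q [pB qA qB pq]]]] := connected_boundary conA (ball_sub (ball D)) dB.
  by exists D; split; rewrite ?(leq_trans leD) ?leq_add2l ?leq_mul2l ?leqnSn //; left.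
have [D1 [cD1 DD1 pD1 leD1]] := core_attach2 cD pB.
have qD1 : q \in ball D1 by apply/in_ball; split=> //; right; exists p.
have [D2 [cD2 DD2 qD2 leD2]] := core_attach cD1 qD1.
have DD : D \subset D2 := subset_trans DD1 DD2.
exists D2; split=> //.
- by apply/set0Pn; exists d; exact: subsetP DD _ dD.
- by move: leD leD1 leD2; clear; lia.
right; have sub : ball D :|: ball [set q] \subset ball D2.
  by rewrite subUset !ballS // sub1set.
have dis : ball D :&: ball [set q] = set0.
  apply/eqP; rewrite -subset0; apply/subsetP=> y /setIP[yD /in_ball[yA yq]].
  case/negP: qB; apply/in_ball; split=> //.
  case: yq => [|[q']]; rewrite inE => /eqP E; first by left; rewrite -E.
  by rewrite E => qy; right; exists y => //; rewrite adj_sym.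
have := subset_leq_card sub; rewrite cardsU dis cards0 subn0.
by move: big (card_ball1 qA); clear; lia.
Qed.

(** Every vertex of U has at least m >= #|A| / 4 neighbours in A, so an average
    vertex of A is adjacent to at least a quarter of U. *)
Lemma popular_vertex (U : {set G}) : U \subset A -> U != set0 ->
  exists2 y, y \in A & #|U| <= 4 * #|nbr y :&: U|.
Proof.
move=> UA U0; apply/exists_inP; apply: contraT.
rewrite negb_exists_in => /forall_inP few.
have U_gt0 : 0 < #|U| by rewrite card_gt0.
have A_gt0 : 0 < #|A| := leq_trans U_gt0 (subset_leq_card UA).
have count : \sum_(y in A) #|nbr y :&: U| = \sum_(u in U) #|nbr u :&: A|.
  under eq_bigr => y _ do rewrite -sum1_card big_mkcond /=.
  under [RHS]eq_bigr => u _ do rewrite -sum1_card big_mkcond /=.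
  rewrite (big_mkcond (mem A)) /= (big_mkcond (mem U)) /=.
  transitivity (\sum_y \sum_u ([&& adj y u, y \in A & u \in U] : nat)).
    apply: eq_bigr => y _; case: ifP => yA; last by rewrite big1 // => u _; rewrite andbF.
    by apply: eq_bigr => u _; rewrite !inE /=; case: (u \in U); case: (adj y u).
  rewrite exchange_big; apply: eq_bigr => u _ /=.
  case: ifP => uU; last by rewrite big1 // => y _; rewrite !andbF.
  by apply: eq_bigr => y _; rewrite !inE /= andbT adj_sym; case: (y \in A); case: (adj u y).
have lower : #|U| * m <= \sum_(u in U) #|nbr u :&: A|.
  by rewrite -sum_nat_const; apply: leq_sum => u uU; exact/degA/(subsetP UA).
have upper : 4 * (\sum_(y in A) #|nbr y :&: U|) <= #|A| * #|U|.-1.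
  rewrite big_distrr -sum_nat_const /=; apply: leq_sum => y yA.
  by have := few y yA; rewrite -ltnNge; clear; lia.
move: upper; rewrite count; move: lower sizeA U_gt0 A_gt0; clear.
by move: (\sum_(u in U) _) #|U| #|A| => S u a; nia.
Qed.

Lemma core_shrink (D : {set G}) : core D -> A \subset ball (ball D) ->
  exists D', [/\ core D', D \subset D', #|D'| <= #|D| + 2 &
    4 * #|A :\: ball D'| <= 3 * #|A :\: ball D|].
Proof.
move=> cD near; set U := A :\: ball D.
have [U0|U0] := eqVneq U set0.
  by exists D; rewrite leq_addr; split=> //; rewrite -/U U0 cards0.
have [y yA pop] := popular_vertex (subsetDl A (ball D)) U0.
have [D' [cD' DD' yD' leD']] := core_attach2 cD (subsetP near _ yA).
exists D'; split=> //.
have sub : A :\: ball D' \subset U :\: (nbr y :&: U).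
  apply/subsetP=> z /setDP[zA zD']; apply/setDP; split.
    by apply/setDP; split=> //; apply: contra zD'; exact/subsetP/ballS.
  apply: contra zD' => /setIP[]; rewrite inE => yz _.
  by apply/in_ball; split=> //; right; exists y.
have := subset_leq_card sub.
rewrite (cardsD U) (setIidPr (subsetIr (nbr y) U)).
by have := subset_leq_card (subsetIr (nbr y) U); move: pop; rewrite -/U; clear; lia.
Qed.

(** Three rounds of [core_shrink] leave at most 27/64 < 1/2 of the undominated
    vertices, and cost at most six new vertices. *)
Lemma core_halve (D : {set G}) : core D -> A \subset ball (ball D) ->
  forall j, exists D', [/\ core D', D \subset D', #|D'| <= #|D| + 6 * j &
    2 ^ j * #|A :\: ball D'| <= #|A :\: ball D|].
Proof.
move=> cD near; elim=> [|j [E [cE DE leE halfE]]].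
  by exists D; split; rewrite ?muln0 ?addn0 ?mul1n.
have keep (E' : {set G}) : D \subset E' -> A \subset ball (ball E').
  by move=> DE'; apply: subset_trans near _; rewrite !ballS.
have [E1 [cE1 EE1 leE1 shE1]] := core_shrink cE (keep _ DE).
have DE1 := subset_trans DE EE1.
have [E2 [cE2 EE2 leE2 shE2]] := core_shrink cE1 (keep _ DE1).
have DE2 := subset_trans DE1 EE2.
have [E3 [cE3 EE3 leE3 shE3]] := core_shrink cE2 (keep _ DE2).
exists E3; split=> //; last 1 first.
- rewrite expnS -mulnA mulnCA (leq_trans _ halfE) // leq_mul2l; apply/orP; right.
  by move: shE1 shE2 shE3; clear; lia.
- exact: subset_trans DE2 EE3.
- by move: leE leE1 leE2 leE3; clear; lia.
Qed.

(** Ten vertices come from [core_near]; after [trunc_log 2 m + 3] halvings the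
    number of undominated vertices is less than 4m / 2^(log2 m + 2) <= 1. *)
Lemma small_connected_dominating_set : A != set0 ->
  exists D, [/\ core D, D != set0, #|D| <= 28 + 6 * trunc_log 2 m & A \subset ball D].
Proof.
move=> /set0Pn[a aA].
have [D [cD D0 leD nearD]] := core_near aA 3.
have near : A \subset ball (ball D).
  by case: nearD => // big; move: sizeA big (subset_leq_card (ball_sub D)); clear; lia.
have [E [cE DE leE halfE]] := core_halve cD near (trunc_log 2 m + 3).
exists E; split=> //; last 1 first.
- rewrite -setD_eq0 -cards_eq0 -leqn0 -ltnS.
  have lt_m : m < 2 ^ (trunc_log 2 m).+1 by exact: trunc_log_ltn.
  have : #|A :\: ball D| <= #|A| by exact/subset_leq_card/subsetDl.
  move: halfE lt_m sizeA; rewrite expnD (expnS 2 (trunc_log 2 m)) (_ : 2 ^ 3 = 8) //; clear.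
  by move: #|A :\: ball E| #|A :\: ball D| #|A| (2 ^ trunc_log 2 m) => u v a p; nia.
- by apply: contraNneq D0 => E0; rewrite -subset0 -E0.
- by move: leE leD; clear; lia.
Qed.
End Domination.

(** * Splitting off dominating branch sets *)

Definition component (G : sgraph) (B : {set G}) (x : G) : {set G} :=
  [set y | connect (adj_in B) x y].

Lemma component_sub (G : sgraph) (B : {set G}) (x : G) :
  x \in B -> component B x \subset B.
Proof.
move=> xB; apply/subsetP=> y; rewrite inE => xy.
have cl : closed (adj_in B) B by move=> a b /and3P[_ -> ->].
by rewrite -(closed_connect cl xy).
Qed.

Lemma component_adj (G : sgraph) (B : {set G}) (x a b : G) : x \in B ->
  a \in component B x -> b \in B -> adj a b -> b \in component B x.
Proof.
move=> xB aC bB ab; have aB := subsetP (component_sub xB) _ aC; move: aC.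
by rewrite !inE => xa; apply: connect_trans xa (connect1 _); apply/and3P.
Qed.

Lemma component_connected (G : sgraph) (B : {set G}) (x : G) :
  x \in B -> connected (component B x).
Proof.
move=> xB; set C := component B x.
have walk p z : z \in C -> path (adj_in B) z p -> connect (adj_in C) z (last z p).
  elim: p z => [|w p IHp] z zC /=; first by move=> _; exact: connect0.
  move=> /andP[/and3P[zw zB wB] wp]; have wC : w \in C := component_adj xB zC wB zw.
  by apply: connect_trans (IHp w wC wp); apply: connect1; apply/and3P.
have from_x y : y \in C -> connect (adj_in C) x y.
  by rewrite inE => /connectP[p xp ->]; apply: walk; rewrite ?inE ?connect0.
move=> a b aC bC; apply: (connect_trans (y := x)); last exact: from_x.
by rewrite connect_adj_in_sym; exact: from_x.
Qed.

Definition supported (H G : sgraph) (A : {set G}) (phi : G -> option H) : Prop :=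
  forall x h, phi x = Some h -> x \in A.

(** Every branch set of [phi] lies in A, so D touches all of them, and s may
    have any neighbours in X. *)
Lemma model_add_dominating (H G : sgraph) (X : {set H}) (s : H) (A D : {set G})
    (phi : G -> option H) :
  s \notin X -> model X phi -> supported A phi ->
  connected D -> D != set0 -> {in D, forall x, x \notin A} ->
  {in A, forall a, exists2 d, d \in D & adj d a} ->
  model (s |: X) (fun x => if x \in D then Some s else phi x).
Proof.
move=> sX [rg ne co ad] supp conD /set0Pn[d0 d0D] disj dom.
set psi := fun x : G => _.
have psi_phi x h : phi x = Some h -> psi x = Some h.
  move=> px; have xA := supp _ _ px; rewrite /psi ifN //.
  by apply: contraL xA => /disj.
have psi_s x : (psi x == Some s) = (x \in D).
  rewrite /psi; case: ifP => [_|_]; first by rewrite eqxx.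
  by apply/eqP=> /rg; apply/negP.
have psi_X x h : h != s -> psi x = Some h -> phi x = Some h.
  by rewrite /psi; case: ifP => // _ /eqP hs [sh]; rewrite sh in hs.
have XnS h : h \in X -> h != s by apply: contraTneq => ->.
have dom_s h : h \in X -> exists x y, [/\ psi x = Some s, psi y = Some h & adj x y].
  move=> hX; have [y py] := ne _ hX; have [d dD dy] := dom _ (supp _ _ py).
  by exists d, y; split=> //; [apply/eqP; rewrite psi_s | exact: psi_phi].
split.
- by move=> x h; rewrite /psi !inE; case: ifP => [_ [<-]|_ /rg->]; rewrite ?eqxx ?orbT.
- move=> h /setU1P[->|/ne[x px]]; last by exists x; exact: psi_phi.
  by exists d0; apply/eqP; rewrite psi_s.
- move=> h; have [->|hs] := eqVneq h s.
    move=> x y; rewrite !inE !psi_s => xD yD; have := conD _ _ xD yD.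
    apply: (connect_homo (f := id)) => a b /and3P[ab aD bD]; apply: connect1.
    by rewrite /adj_in ab !inE !psi_s aD.
  move=> x y; rewrite !inE => /eqP/(psi_X _ _ hs) px /eqP/(psi_X _ _ hs) py.
  have : connect (adj_in [pred x | phi x == Some h]) x y by apply: co; rewrite inE; apply/eqP.
  apply: (connect_homo (f := id)) => a b /and3P[ab]; rewrite !inE => /eqP pa /eqP pb.
  by apply: connect1; rewrite /adj_in ab !inE (psi_phi _ _ pa) (psi_phi _ _ pb) eqxx.
- move=> h k /setU1P[->|hX] /setU1P[->|kX] hk.
  + by rewrite adj_irrefl in hk.
  + exact: dom_s.
  + have [x [y [px py xy]]] := dom_s _ hX.
    by exists y, x; rewrite adj_sym.
  + have [x [y [px py xy]]] := ad _ _ hX kX hk.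
    by exists x, y; split=> //; exact: psi_phi.
Qed.

(** By induction on the number of vertices still to be added to X0. Each round
    removes at most [28 + 6 * trunc_log 2 m] vertices, so it lowers the minimum
    degree by at most that much; passing to a component afterwards does not
    lower it, and makes the next dominating set available. *)
Lemma model_in_dense_set (H G : sgraph) (X0 : {set H}) (m : nat) :
  (forall A : {set G}, A != set0 -> {in A, forall x, m <= #|nbr x :&: A|} ->
     exists2 phi : G -> option H, model X0 phi & supported A phi) ->
  forall k (X : {set H}) (A : {set G}), X0 \subset X -> #|X :\: X0| = k ->
    A != set0 -> #|A| <= 4 * m ->
    {in A, forall x, m + k * (28 + 6 * trunc_log 2 m) <= #|nbr x :&: A|} ->
    exists2 phi : G -> option H, model X phi & supported A phi.
Proof.
move=> base; set L := 28 + _; elim=> [|k IHk] X A X0X cardX A0 sizeA degA.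
  have -> : X = X0.
    by apply/eqP; rewrite eqEsubset X0X andbT -setD_eq0 -cards_eq0 cardX.
  by apply: base => // x xA; rewrite -[m]addn0; exact: degA.
have /card_gt0P[s /setDP[sX sX0]] : 0 < #|X :\: X0| by rewrite cardX.
(* The branch set of s is found inside one component of A. *)
have [x xA] := set0Pn _ A0; pose C := component A x.
have CA : C \subset A := component_sub xA.
have degC : {in C, forall a, m + k.+1 * L <= #|nbr a :&: C|}.
  move=> a aC; apply: leq_trans (degA a (subsetP CA _ aC)) _.
  apply/subset_leq_card/subsetP=> b; rewrite !inE => /andP[ab bA]; rewrite ab.
  by have := component_adj xA aC bA ab; rewrite inE.
have sizeC : #|C| <= 4 * m := leq_trans (subset_leq_card CA) sizeA.
have xC : x \in C by rewrite inE connect0.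
have [] := small_connected_dominating_set (component_connected xA) _ sizeC.
- by move=> a /degC; apply: leq_trans; rewrite leq_addr.
- by apply/set0Pn; exists x.
move=> D [[DC conD] D0 leD domD].
pose B := C :\: D.
have degB : {in B, forall a, m + k * L <= #|nbr a :&: B|}.
  move=> a /setDP[aC aD].
  have sub : nbr a :&: C \subset (nbr a :&: B) :|: D.
    apply/subsetP=> b /setIP[ab bC]; apply/setUP; have [bD|bD] := boolP (b \in D); first by right.
    by left; apply/setIP; split=> //; apply/setDP.
  have := leq_trans (subset_leq_card sub) (leq_card_setU _ _).
  move: (degC a aC) leD; rewrite -/L mulSn; clear.
  by move: #|nbr a :&: C| #|nbr a :&: B| #|D| (k * L) => u v w z; lia.
have B0 : B != set0.
  rewrite -card_gt0.
  have : #|C| <= #|B| + #|D| by rewrite -(cardsID D C) addnC leq_add2l subset_leq_card ?subsetIr.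
  have := leq_trans (degC x xC) (subset_leq_card (subsetIr _ _)).
  have xN : nbr x :&: C \subset C :\ x.
    by apply/subsetP=> b /setIP[]; rewrite inE => xb bC; apply/setD1P; rewrite eq_sym adj_neq.
  have := subset_leq_card xN; have := cardsD1 x C; rewrite xC.
  move: (degC x xC) leD; rewrite -/L mulSn; clear.
  move: #|nbr x :&: C| #|C :\ x| #|C| #|B| #|D| (k * L) => a b c e f g; lia.
have BA : B \subset A := subset_trans (subsetDl _ _) CA.
have [|||||phi mod supp] := IHk (X :\ s) B.
- by rewrite subsetD1 X0X.
- have := cardsD1 s (X :\: X0); rewrite cardX !inE sX sX0 /= add1n => -[->].
  by apply: eq_card => h; rewrite !inE; case: (h == s); rewrite ?andbF.
- exact: B0.
- exact: leq_trans (subset_leq_card BA) sizeA.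
- exact: degB.
have XE : X = s |: X :\ s by rewrite setD1K.
exists (fun x => if x \in D then Some s else phi x).
  rewrite XE; apply: (model_add_dominating (A := B)) => //.
  - by rewrite !inE eqxx.
  - by move=> d dD; rewrite inE dD.
  - move=> a /setDP[aC aD]; case/in_ball: (subsetP domD _ aC) => _ [|[d dD da]].
      by rewrite (negPf aD).
    by exists d.
move=> y h; case: ifP => [yD _|_ /supp]; last exact: subsetP.
exact: subsetP CA _ (subsetP DC _ yD).
Qed.

(** * The numerical budget *)

Local Open Scope ring_scope.

(** With T = t, M = m and l = ln T, the estimates are: l >= 1, because
    e <= (6/5)^6 < 3; log2 m <= 2 ln M, because e^(1/2) <= 2; and
    ln M <= l + M/T, because ln x <= x - 1. Hence
    28 + 6 log2 m <= 28 + 12 (l + M/T) <= l (40 + 12 M/T), and multiplying by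
    s <= T / (100 l) gives at most 2T/5 + 3M/25, which is at most M since T <= 2M. *)
Lemma dominating_sets_fit (R : realType) (eps : R) (s t m : nat) :
  0 < eps -> eps <= 1 -> (3 <= t)%N -> s%:R <= eps / 100 * (t%:R / ln t%:R) ->
  (t <= 2 * m)%N -> (s * (28 + 6 * trunc_log 2 m) <= m)%N.
Proof.
move=> eps0 eps1 t3 s_le tm.
have m0 : (0 < m)%N by lia.
set k := trunc_log 2 m; set T : R := t%:R; set M : R := m%:R; set l := ln T.
have T3 : 3 <= T by rewrite ler_nat.
have TM : T <= 2 * M by rewrite -natrM ler_nat.
have T0 : 0 < T by lra.
have M0 : 0 < M by lra.
have l1 : 1 <= l.
  rewrite -ler_expR lnK // (le_trans _ T3) //.
  have e6 : expR (- 6^-1 : R) >= 5 / 6 by apply: le_trans (expR_ge1Dx _); lra.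
  have eE : expR (- 6^-1 : R) ^+ 6 = (expR 1)^-1.
    by rewrite -expRM_natl -expRN; congr expR; lra.
  have : (5 / 6) ^+ 6 <= (expR 1)^-1 :> R by rewrite -eE lerXn2r ?nnegrE ?expR_ge0 //; lra.
  have e_gt0 := expR_gt0 (1 : R).
  by rewrite -[(expR _)^-1]mul1r ler_pdivlMr //; lra.
have ln2 : 1 / 2 <= ln 2 :> R.
  rewrite -ler_expR lnK ?qualifE //=.
  have e_gt0 := expR_gt0 (1 / 2 : R).
  have := expR_ge1Dx (- (1 / 2) : R); rewrite expRN.
  by rewrite -[(expR _)^-1]mul1r ler_pdivlMr //; lra.
have kM : k%:R <= 2 * ln M.
  have : ln (2 ^+ k) <= ln M.
    rewrite ler_ln ?qualifE //= ?exprn_gt0 // -natrX ler_nat.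
    by rewrite trunc_logP.
  rewrite lnXn // -(mulr_natr (ln 2)) => h; have k0 : (0 : R) <= k%:R by rewrite ler0n.
  by have := ler_wpM2r k0 ln2; lra.
have lnM_le : ln M <= l + M / T.
  have -> : M = T * (M / T) by rewrite mulrCA divff ?mulr1 // gt_eqF.
  have MT0 : 0 < M / T by rewrite divr_gt0.
  rewrite lnM ?qualifE //= lerD2l [X in _ <= X / _]mulrCA divff ?mulr1 ?gt_eqF //.
  have := expR_ge1Dx (ln (M / T)); rewrite lnK ?qualifE //; lra.
have slT : s%:R * l <= T / 100.
  have : s%:R * l <= eps / 100 * (T / l) * l by rewrite ler_wpM2r //; lra.
  by rewrite -!mulrA mulVf ?gt_eqF //; nra.
rewrite -(ler_nat R) natrM natrD natrM -/M.
have s0 : 0 <= s%:R :> R by rewrite ler0n.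
have MT : M / T * T = M by rewrite divfK // gt_eqF.
have MT0 : 0 <= M / T by rewrite divr_ge0 // ltW.
have L_le : 28 + 6 * k%:R <= l * (40 + 12 * (M / T)) by nra.
apply: (le_trans (ler_wpM2l s0 L_le)).
have X0 : 0 <= 40 + 12 * (M / T) by lra.
rewrite (mulrA s%:R); apply: (le_trans (ler_wpM2r X0 slT)).
have -> : T / 100 * (40 + 12 * (M / T)) = 2 / 5 * T + 3 / 25 * (M / T * T) by lra.
by rewrite MT; lra.
Qed.

(** * Densities *)

Lemma avg_degreeE (R : realType) (G : sgraph) :
  avg_degree R G = #|arcs G|%:R / #|G|%:R.
Proof. by rewrite /avg_degree card_arcs natrM. Qed.

Definition forces_minor (R : realType) (H : sgraph) : classical_sets.set R :=
  [set D : R | forall G : sgraph,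
     (0 < #|G|)%N -> D <= avg_degree R G -> minor H G]%classic.
Arguments forces_minor : clear implicits.

(** The complete graph on t - 1 vertices is too small to contain H. *)
Lemma forces_minor_lbound (R : realType) (H : sgraph) (t : nat) : (1 < t)%N -> (t <= #|H|)%N ->
  lbound (forces_minor R H) (t%:R - 2).
Proof.
move=> t1 tH D forceD; rewrite leNgt; apply/negP => Dlt.
have cardK : #|complete_graph t.-1| = t.-1 := card_ord _.
have t_gt0 : (0 < t.-1)%N by lia.
have /minor_card : minor H (complete_graph t.-1).
  apply: forceD; rewrite ?cardK // avg_degreeE card_arcs_complete cardK natrM.
  rewrite mulrAC divff ?mul1r ?pnatr_eq0 -?lt0n //; apply: ltW; apply: lt_le_trans Dlt _.
  by rewrite lerBlDr -natrD ler_nat; lia.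
by rewrite cardK; lia.
Qed.

Lemma model_of_dense_set (R : realType) (H G : sgraph) (S : {set H}) (m : nat) (A : {set G}) :
  (exists2 D, forces_minor R (del_vertices S) D & D <= m%:R) ->
  A != finset.set0 -> {in A, forall x, m <= #|nbr x :&: A|}%N ->
  exists2 phi : G -> option H, model (~: S) phi & supported A phi.
Proof.
move=> [D forceD Dm] A0 degA.
have cardA : #|del_vertices (~: A)| = #|A| by rewrite card_del_vertices setCK.
have A_gt0 : (0 < #|A|)%N by rewrite card_gt0.
have /minor_model[phi /model_of_del_vertices/model_induced mod] :
    minor (del_vertices S) (del_vertices (~: A)).
  apply: forceD; rewrite ?cardA //; apply: le_trans Dm _.
  by rewrite avg_degreeE cardA ler_pdivlMr ?ltr0n // -natrM ler_nat arcs_induced.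
eexists; first exact: mod.
move=> x h; case: insubP => //= a xA _ _.
by move: xA; rewrite inE negbK.
Qed.

(** The neighbourhood found in G has minimum degree 2m; the dominating sets use
    up at most m of it, which leaves enough for H - S. *)
Lemma minor_of_dense (R : realType) (H G : sgraph) (S : {set H}) (m : nat) :
  (0 < m)%N -> (#|S| * (28 + 6 * trunc_log 2 m) <= m)%N ->
  (exists2 D, forces_minor R (del_vertices S) D & D <= m%:R) ->
  (0 < #|G|)%N -> (4 * m * #|G| <= #|arcs G|)%N -> minor H G.
Proof.
move=> m0 fit force G0 dense.
apply: (minor_of_dense_nbhd (k := 2 * m)) G0 _; rewrite ?muln_gt0 // ?mulnA //.
move=> {dense}G v /andP[nv0 nv_le] deg.
have [|||||phi mod _] := model_in_dense_set (fun A => @model_of_dense_set R H G S m A force)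
  (k := #|S|) (X := [set: H]) (A := nbr v).
- exact: subsetT.
- by rewrite setTD setCK.
- by rewrite -card_gt0.
- exact: nv_le.
- move=> x /deg; apply: leq_trans; rewrite mul2n -addnn leq_add2l //.
exact: model_minor mod.
Qed.

Theorem theorem2 (R : realType) (eps : R) (s t : nat)
    (eps_gt0 : 0 < eps) (eps_le1 : eps <= 1) (t_ge3 : (3 <= t)%N)
    (s_le : s%:R <= eps / 100 * (t%:R / ln t%:R))
    (H : sgraph) (cardH : #|H| = (s + t)%N)
    (S : {set H}) (cardS : #|S| = s) :
  minor_density R H
    <= 4 * (Num.ceil ((1 + eps) * minor_density R (del_vertices S)))%:~R.
Proof.
rewrite /minor_density -/(forces_minor R H) -/(forces_minor R (del_vertices S)).
set F := forces_minor R H; set F' := forces_minor R (del_vertices S).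
have FF' : (F `<=` F')%classic.
  by move=> D forceD G G0 /(forceD G G0); exact: minor_del_vertices.
have cardH' : #|del_vertices S| = t.
  by have := cardsC S; rewrite card_del_vertices cardS cardH; lia.
have F'lb : lbound F' (t%:R - 2) by apply: forces_minor_lbound; rewrite ?cardH'; lia.
have [F'0|/set0P F'0] := eqVneq F' classical_sets.set0.
  have -> : F = classical_sets.set0.
    by apply/seteqP; split=> // D /FF'; rewrite F'0.
  by rewrite F'0 inf0 mulr0 ceil0 mulr0.
set f := inf F'.
have t3 : 3 <= t%:R :> R by rewrite ler_nat.
have f_ge : t%:R - 2 <= f := lb_le_inf F'0 F'lb.
have ceil_ge := ceil_ge ((1 + eps) * f).
have ceil_pos : 0 < Num.ceil ((1 + eps) * f) by rewrite ceil_gt0; nra.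
case: (Num.ceil _) ceil_pos ceil_ge => // m; rewrite ltz_nat => m0.
rewrite -pmulrn => m_ge.
have tm : (t <= 2 * m)%N.
  have : t%:R < m.+2%:R :> R by rewrite -addn2 natrD; nra.
  by rewrite ltr_nat; lia.
apply: ge_inf; first by exists (t%:R - 2) => D /FF' /F'lb.
move=> G G0; rewrite avg_degreeE ler_pdivlMr ?ltr0n // -natrM -natrM ler_nat.
apply: (minor_of_dense (R := R) (S := S) m0 _ _ G0).
  by rewrite cardS; exact: dominating_sets_fit s_le tm.
have [] := @inf_lt R F' m%:R F'0; first by rewrite -/f; nra.
by move=> D FD /ltW; exists D.
Qed.
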